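(* Let $n\ge 1$, let $K\subset\mathbb{R}^n$ be an origin-symmetric convex body, and let $\Lambda\subset\mathbb{R}^n$ be a full-rank lattice. Let $0\le r\le n$, and let $v_1,\ldots,v_r\in\Lambda$ be any lattice vectors such that, for every $1\le i\le r$, $v_i\in\lambda_i(K,\Lambda)K$ and $v_1,\ldots,v_i$ are linearly independent. Let $L_r=\operatorname{lin}(v_1,\ldots,v_r)$ (with $L_0=\{0\}$), let $\pi_{L_r}:\mathbb{R}^n\to L_r^\perp$ be the orthogonal projection, and let $\rho_{L_r}=\mu(\pi_{L_r}(K),\pi_{L_r}(\Lambda))$ be the covering radius of the projected body $\pi_{L_r}(K)$ with respect to the projected lattice $\pi_{L_r}(\Lambda)$ in $L_r^\perp$. Then $$ \left(\prod_{i=1}^r \lambda_i(K,\Lambda)\right)\rho_{L_r}^{\,n-r}\ \ge\ \frac{2^r (n-r)!}{n!}\,\frac{\det(\Lambda)}{\operatorname{vol}_n(K)}, $$ where for $r=n$ the factor $\rho_{L_r}^{\,n-r}$ is by convention equal to $1$, and an empty product equals $1$.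
   Context: A convex body in $\mathbb{R}^n$ is a compact convex set with nonempty interior; it is origin-symmetric if $x\in K$ if and only if $-x\in K$. A full-rank lattice in $\mathbb{R}^n$ is a set $\Lambda=\{Bx: x\in\mathbb{Z}^n\}$ with $B\in\mathbb{R}^{n\times n}$ invertible, and $\det(\Lambda)=|\det(B)|$. $\operatorname{vol}_n$ is $n$-dimensional Lebesgue measure and $\operatorname{lin}(A)$ is the linear span of $A$. For an origin-symmetric convex body $K$ and a full-rank lattice $\Lambda$, the $i$-th successive minimum ($1\le i\le n$) is $\lambda_i(K,\Lambda)=\min\{\lambda>0:\dim(\lambda K\cap\Lambda)\ge i\}$, where $\dim(A)$ is the dimension of the linear span of $A$. The covering radius of a convex body $K$ with respect to a full-rank lattice $\Lambda$ in a Euclidean space $V$ is $\mu(K,\Lambda)=\inf\{\mu>0:\mu K+\Lambda=V\}$. In particular, for $\pi_{L_r}(K)$ and $\pi_{L_r}(\Lambda)$ the ambient space is $V=L_r^\perp$. Vectors $v_1,\ldots,v_r$ as in the statement always exist, by the definition of the successive minima. *)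

(* Defs.v *)
From HB Require Import structures.
From mathcomp Require Import all_boot all_order all_algebra.
From mathcomp Require Import all_classical all_reals all_analysis.

Set Implicit Arguments.
Unset Strict Implicit.
Unset Printing Implicit Defensive.

Import Order.TTheory GRing.Theory Num.Theory.
Import numFieldNormedType.Exports.

Local Open Scope classical_set_scope.
Local Open Scope ring_scope.

(* R^n is 'rV[R]_n (row vectors), with its product topology. *)

Section Sets.
Context {R : realType} {n : nat}.
Implicit Types (A B K : set 'rV[R]_n) (a : R).

Definition dilate a A : set 'rV[R]_n := [set a *: x | x in A].

Definition minkowski A B : set 'rV[R]_n := [set x + y | x in A & y in B].

Definition convex_body K : Prop :=
  [/\ compact K, convex_set K & K° !=set0].

Definition origin_symmetric K : Prop := forall x, K x <-> K (- x).

Definition is_lin A (U : {vspace 'rV[R]_n}) : Prop :=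
  A `<=` [set` U] /\
  forall W : {vspace 'rV[R]_n}, A `<=` [set` W] -> (U <= W)%VS.

(* The linear span of an arbitrary, possibly infinite, set: the least subspace
   containing it. *)
Definition lin A : {vspace 'rV[R]_n} := xget 0%VS (is_lin A).

Lemma linP A : is_lin A (lin A).
Proof.
rewrite /lin; case: xgetP => [//|noU].
suff [U AU] : exists U, is_lin A U by case: (noU U).
pose P d := `[< exists2 U : {vspace 'rV[R]_n}, A `<=` [set` U] & \dim U = d >].
have exP : exists d, P d.
  exists (\dim {:'rV[R]_n}); apply/asboolP; exists fullv => // x _.
  by rewrite /= memvf.
case: (ex_minnP exP) => d /asboolP[U AU <-] dmin.
exists U; split=> // W AW; apply/capv_idPl/eqP.
rewrite eqEdim capvSl dmin//; apply/asboolP; exists (U :&: W)%VS => // x Ax.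
by rewrite /= memv_cap; apply/andP; split; [exact: AU|exact: AW].
Qed.

Definition lin_dim A : nat := \dim (lin A).

(* The least element of a set of reals; by convention 0 if there is none. *)
Definition set_min (S : set R) : R := xget 0 (S `&` lbound S).

End Sets.

Definition dot {R : realType} {n : nat} (u v : 'rV[R]_n) : R :=
  \sum_i u 0 i * v 0 i.

Section Dot.
Context {R : realType} {n : nat}.

Lemma dot_is_bilinear : bilinear_for
  (GRing.Scale.Law.clone _ _ *%R _) (GRing.Scale.Law.clone _ _ (idfun \; *%R) _)
  (@dot R n).
Proof.
split=> [u'|u] a x y /=; rewrite /dot mulr_sumr -big_split/=;
  apply: eq_bigr => i _; rewrite !mxE.
  by rewrite mulrDl mulrA.
by rewrite mulrDr mulrCA.
Qed.

HB.instance Definition _ := bilinear_isBilinear.Build R _ _ _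
  (GRing.Scale.Law.clone _ _ *%R _) (GRing.Scale.Law.clone _ _ (idfun \; *%R) _)
  (@dot R n) dot_is_bilinear.

Lemma dot_is_symmetric (u v : 'rV[R]_n) :
  dot u v = (-1) ^+ false * idfun (dot v u).
Proof. by rewrite mul1r /=; apply: eq_bigr => i _; rewrite mulrC. Qed.

HB.instance Definition _ :=
  isHermitianSesquilinear.Build R _ false idfun (@dot R n) dot_is_symmetric.

End Dot.

Section Projection.
Context {R : realType} {n : nat}.
Implicit Types (L : {vspace 'rV[R]_n}) (x : 'rV[R]_n).

Definition orth_compl L : {vspace 'rV[R]_n} := orthov (@dot R n) L.

(* Projection onto orth_compl L along L; see proj_complP. *)
Definition proj_compl L : 'End('rV[R]_n) := daddv_pi (orth_compl L) L.

Lemma orth_compl_disjoint L : (orth_compl L :&: L = 0)%VS.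
Proof.
apply/eqP; rewrite -subv0; apply/subvP => x.
rewrite memv_cap memv0 => /andP[/mem_orthovP/(_ x) xx xL].
have /eqP := xx xL; rewrite psumr_eq0 => [|i _]; last by rewrite -expr2 sqr_ge0.
move=> /allP x0; apply/eqP/rowP => i; apply/eqP.
by have := x0 i (mem_index_enum i); rewrite mulf_eq0 orbb mxE.
Qed.

Lemma orth_compl_add L : (orth_compl L + L = fullv)%VS.
Proof.
apply/eqP; rewrite eqEdim subvf/= dimv_disjoint_sum ?orth_compl_disjoint//.
pose g x : 'rV[R]_(\dim L) := \row_i dot x (vbasis L)`_i.
have g_lin : linear g.
  move=> a x y; apply/rowP => i; rewrite !mxE /dot mulr_sumr -big_split/=.
  by apply: eq_bigr => j _; rewrite !mxE mulrDl mulrA.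
pose f := linfun (HB.pack_for {linear 'rV[R]_n -> 'rV[R]_(\dim L)} g
  (GRing.isLinear.Build _ _ _ _ _ g_lin)).
have kerS : (lker f <= orth_compl L)%VS.
  apply/subvP => x; rewrite memv_ker lfunE/= => /eqP gx0.
  apply/mem_orthovP => y /coord_vbasis ->.
  rewrite linear_sumr big1// => i _; rewrite linearZr_LR/=.
  by have /rowP/(_ i) := gx0; rewrite !mxE => ->; rewrite mulr0.
rewrite -(limg_ker_dim f fullv) capfv leq_add ?dimvS//.
by rewrite (leq_trans (dimvS (subvf _)))// dimvf dim_matrix mul1r.
Qed.

Lemma proj_complP L x :
  proj_compl L x \in orth_compl L /\ x - proj_compl L x \in L.
Proof.
split; first exact: memv_pi.
have xs : (x \in orth_compl L + L)%VS by rewrite orth_compl_add memvf.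
rewrite -{1}(daddv_pi_add (orth_compl_disjoint L) xs) addrC addKr.
exact: memv_pi.
Qed.

End Projection.

Section Volume.
Context {R : realType}.

(* n-dimensional Lebesgue measure of a Borel set, as the n-fold product of the
   one-dimensional one: the (n+1)-dimensional volume is the integral over x of
   the n-dimensional volume of the section {y | (x, y) in A}. *)
Fixpoint vol (n : nat) : set 'rV[R]_n -> \bar R :=
  match n return set 'rV[R]_n -> \bar R with
  | 0 => fun A => (\1_A 0)%:E
  | m.+1 => fun A : set 'rV[R]_(1 + m) =>
      (\int[@lebesgue_measure R]_x vol [set y : 'rV[R]_m | A (row_mx x%:M y)])%E
  end.

End Volume.

Section Lattice.
Context {R : realType} {n : nat}.
Implicit Types (K Lam : set 'rV[R]_n) (B : 'M[R]_n) (V : {vspace 'rV[R]_n}).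

(* The lattice whose basis vectors are the rows of B, the transpose of the
   column convention {B x | x in Z^n}; its determinant is `|\det B|. *)
Definition lattice B : set 'rV[R]_n :=
  [set map_mx intr z *m B | z in [set: 'rV[int]_n]].

Definition succ_min K Lam (i : nat) : R :=
  set_min [set l : R | 0 < l /\ (i <= lin_dim (dilate l K `&` Lam))%N].

(* Covering radius in the ambient space V. *)
Definition covering_radius V K Lam : R :=
  inf [set m : R | 0 < m /\ minkowski (dilate m K) Lam = [set` V]].

End Lattice.

(* Main.v *)
Require Import Defs.
From HB Require Import structures.
From mathcomp Require Import all_boot all_order all_algebra.
From mathcomp Require Import fingroup perm.
From mathcomp Require Import all_classical all_reals all_analysis.
From mathcomp Require Import measurable_realfun.
From mathcomp Require Import zify ring lra.

Set Implicit Arguments.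
Unset Strict Implicit.
Unset Printing Implicit Defensive.

Import Order.TTheory GRing.Theory Num.Theory.
Import numFieldNormedType.Exports.

Local Open Scope classical_set_scope.
Local Open Scope ring_scope.

(** Why the inequality holds.  Put d = n - r and write lambda_i for the
    successive minima.  The volume of K is compared with numbers of lattice
    points in large dilates T K, and these numbers are bounded below.

    Lattice points bound the volume from below ([vol_ge_lattice_count]): if
    T K contains N points of the lattice, then
    vol K >= N |det B| / (T + C)^n with C independent of T.  To see this,
    factor B = P^-1 L U with P a permutation matrix, L unit lower triangular
    and U upper triangular.  Rounding z P^-1 L down to an integer vector is
    injective in z and displaces z B by a bounded amount, so the lattice points
    can be traded for disjoint translates of the box [0,1)^n U.  As U is
    triangular, the volume of a union of such boxes is read off from its
    iterated sections ([vol_ge_boxes]).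

    Counting starts modulo L = lin(v_1, ..., v_r).  If m pi(K) + pi(Lambda)
    covers the orthogonal complement of L, then every class of
    (1/N) pi(Lambda) modulo pi(Lambda) meets m pi(K), and there are at least
    N^d such classes; hence m N pi(K) contains at least N^d points of
    pi(Lambda) ([count_ge_covering]).

    The directions v_i are then restored one at a time
    ([count_growth_step]).  Let W = W' + R v with v a lattice vector in
    lambda K.  A class modulo W that has a representative in
    (T - lambda b) K has at least 2 b lifts modulo W' with a representative in
    T K, since v may be added to it with real coefficient in [-b, b].  Summing
    over b turns a count of order c T^p modulo W into one of order
    2 c / (lambda (p + 1)) T^(p + 1) modulo W'.

    From c = m^-d and p = d, the r steps lead to
    2^r d! / (n! m^d prod lambda_i) T^n lattice points in T K, to leading
    order.  Comparing with the volume and letting T tend to infinity gives the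
    inequality with m in place of rho; it remains to take the infimum over the
    admissible m. *)

(** * Volumes of unions of triangular boxes *)

(** The integral of a nonnegative function is a supremum over the simple
    functions below it.  In this generality the bound applies to the volumes of
    the sections of an arbitrary set. *)
Lemma ge0_le_integralT d (T : measurableType d) (R : realType)
    (mu : {measure set T -> \bar R}) (f g : T -> \bar R) :
  (forall x, (0 <= f x)%E) -> (forall x, (f x <= g x)%E) ->
  (\int[mu]_x f x <= \int[mu]_x g x)%E.
Proof.
move=> f0 fg; have g0 x : (0 <= g x)%E by exact: le_trans (f0 x) (fg x).
rewrite !ge0_integralTE//; apply: ereal_sup_le => _ [h /= hf <-].
by exists h => //= x; exact: le_trans (hf x) (fg x).
Qed.

Section Vol.
Context {R : realType}.

Lemma vol_ge0 n (A : set 'rV[R]_n) : (0 <= vol A)%E.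
Proof.
elim: n A => [|n IHn] A /=; first by rewrite lee_fin.
by apply: integral_ge0 => x _; exact: IHn.
Qed.

(** The points of the half-open interval from c + k a to c + (k + 1) a; as a
    preimage under the floor function it has one formula for both signs of
    a. *)
Definition cell (c a : R) (k : int) : set R :=
  [set x | Num.floor ((x - c) / a) = k].

Lemma cellE (c a : R) k : a != 0 ->
  cell c a k =
    [set` if 0 < a then `[c + k%:~R * a, c + (k + 1)%:~R * a[
          else `]c + (k + 1)%:~R * a, c + k%:~R * a]].
Proof.
move=> a0; apply/seteqP; split => x; rewrite /cell/=.
  move/eqP; rewrite floor_eq => /andP[lo hi].
  case: ltP => [a_gt0|a_le0].
    by rewrite /= in_itv/= -!lerBrDl -ltrBlDl -ler_pdivlMr// lo -ltr_pdivrMr.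
  have a_lt0 : a < 0 by rewrite lt_neqAle a0.
  by rewrite /= in_itv/= -ltrBrDl -lerBlDl -ltr_ndivrMr// hi -ler_ndivlMr.
move=> h; apply/eqP; rewrite floor_eq; move: h.
case: ltP => [a_gt0|a_le0].
  by rewrite /= in_itv/= -!lerBrDl -ltrBlDl -ler_pdivlMr// -ltr_pdivrMr.
have a_lt0 : a < 0 by rewrite lt_neqAle a0.
by rewrite /= in_itv/= -ltrBrDl -lerBlDl -ltr_ndivrMr// -ler_ndivlMr// andbC.
Qed.

Lemma measurable_cell (c a : R) k : a != 0 -> measurable (cell c a k).
Proof. by move=> a0; rewrite cellE//; case: ifP => _; exact: measurable_itv. Qed.

Lemma measure_cell (c a : R) k : a != 0 ->
  @lebesgue_measure R (cell c a k) = `|a|%:E.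
Proof.
move=> a0; rewrite cellE//; case: ltP => [a_gt0|a_le0].
  rewrite lebesgue_measure_itv/= lte_fin ltrD2l intrD mulrDl mul1r ltrDl a_gt0.
  by rewrite -EFinB gtr0_norm//; congr EFin; ring.
have a_lt0 : a < 0 by rewrite lt_neqAle a0.
rewrite lebesgue_measure_itv/= lte_fin ltrD2l intrD mulrDl mul1r gtrDl a_lt0.
by rewrite -EFinB ltr0_norm//; congr EFin; ring.
Qed.

(** The integrand is a step function: an entry k of ks contributes D on its cell,
    which has measure |a|. *)
Lemma integral_cells (c a D : R) (ks : seq int) : a != 0 -> 0 <= D ->
  (\int[@lebesgue_measure R]_x
     (D * (count_mem (Num.floor ((x - c) / a)) ks)%:R)%:E =
   ((size ks)%:R * (`|a| * D))%:E)%E.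
Proof.
move=> a0 D0.
transitivity (\int[@lebesgue_measure R]_x
    \sum_(k <- ks) (D%:E * (\1_(cell c a k) x)%:E))%E.
  apply: eq_integral => x _; rewrite -ge0_sume_distrr// sumEFin -EFinM.
  congr (D * _)%:E; rewrite -sum1_count natr_sum big_mkcond/=.
  apply: eq_bigr => k _; rewrite indicE eq_sym.
  by case: eqP => e; [rewrite mem_set|rewrite memNset].
have mcell k : measurable_fun [set: measurableTypeR R]
    (fun x : measurableTypeR R => (\1_(cell c a k) x)%:E : \bar R).
  by apply/measurable_EFinP; apply: measurable_indic; exact: measurable_cell.
rewrite ge0_integral_sum//; last 2 first.
- by move=> k; exact: (measurable_funeM _ (mcell k)).
- by move=> k x _; rewrite mule_ge0// lee_fin.
transitivity (\sum_(k <- ks) (D * `|a|)%:E)%E.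
  apply: eq_bigr => k _.
  rewrite ge0_integralZl_EFin//.
  rewrite integral_indic//; last exact: measurable_cell.
  by rewrite setIT [X in (_ * X)%E]measure_cell// -EFinM.
rewrite sumEFin; congr EFin.
by rewrite big_const_seq count_predT iter_addr_0 mulr_natl (mulrC D).
Qed.

(** The first coordinate of a point of the translated box determines the integer
    part k and the fractional part l - k of its first parameter; the remaining
    coordinates then run through a translated box for the lower right block. *)
Lemma box_rowE n (c0 k l a x : R) (c' y u b : 'rV[R]_n) (U : 'M[R]_n) :
  c0 + l * a = x ->
  row_mx c0%:M c' +
    (row_mx k%:M y + row_mx (l - k)%:M u) *m block_mx a%:M b 0 U =
  row_mx x%:M (c' + l *: b + (y + u) *m U).
Proof.
move=> <-; rewrite add_row_mx -raddfD/= subrKC mul_row_block add_row_mx.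
by rewrite mulmx0 addr0 -scalar_mxM mul_scalar_mx -raddfD/= addrA.
Qed.

(** For invertible U the boxes c + (z + [0,1)^n) U are disjoint, of volume
    |det U|.  The section of their union at first coordinate x consists of the boxes in
    dimension n - 1 for those z whose first entry is the floor of
    (x - c_0) / U_00, translated by a vector depending on x; this is why the
    induction needs an arbitrary translation c. *)
Lemma vol_ge_boxes n (U : 'M[R]_n) (c : 'rV[R]_n) (S : seq 'rV[int]_n)
    (A : set 'rV[R]_n) :
  (forall i j : 'I_n, (j < i)%N -> U i j = 0) -> uniq S ->
  (forall z (u : 'rV_n), z \in S -> (forall j, 0 <= u 0 j < 1) ->
     A (c + (map_mx intr z + u) *m U)) ->
  (((size S)%:R * \prod_i `|U i i|)%:E <= vol A)%E.
Proof.
elim: n U c S A => [|n IHn] U c S A Utri Suniq SA.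
  rewrite big_ord0 mulr1 /=.
  case: S Suniq SA => [|z [|z' S]] //=; first by rewrite !lee_fin.
    move=> _ SA; rewrite indicE mem_set//.
    have := SA z 0; rewrite mem_head => /(_ isT) SA0.
    rewrite (_ : 0 = c + (map_mx intr z + 0) *m U); last by apply/rowP => -[].
    by apply: SA0 => -[].
  by move=> /andP[]; rewrite inE (thinmx0 z) (thinmx0 z') eqxx.
pose a : R := U 0 0.
have [a0|a0] := eqVneq a 0.
  by rewrite big_ord_recl -/a a0 normr0 mul0r mulr0 vol_ge0.
pose U1 : 'M[R]_(1 + n) := U.
pose b := ursubmx U1; pose U' := drsubmx U1.
pose D := \prod_i `|U' i i|.
have D0 : 0 <= D by apply: prodr_ge0.
have UE : U1 = block_mx a%:M b 0 U'.
  rewrite -[LHS]submxK; congr block_mx.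
    by apply/matrixP => i j; rewrite !mxE !ord1 /= /a; congr (U _ _); exact/val_inj.
  by apply/matrixP => i j; rewrite !mxE Utri//= !ord1.
pose c0 := c 0 0; pose c' : 'rV_n := rsubmx (c : 'rV_(1 + n)).
have cE : c = row_mx c0%:M c' :> 'rV_(1 + n).
  rewrite -[LHS](@hsubmxK _ 1 1 n); congr row_mx.
  by apply/matrixP => i j; rewrite !mxE !ord1 /= /c0; congr (c _ _); exact/val_inj.
pose hd (z : 'rV[int]_n.+1) := z 0 0.
pose tl (z : 'rV[int]_n.+1) : 'rV_n := rsubmx (z : 'rV_(1 + n)).
have zE z : z = row_mx (hd z)%:M (tl z) :> 'rV_(1 + n).
  rewrite -[LHS](@hsubmxK _ 1 1 n); congr row_mx.
  by apply/matrixP => i j; rewrite !mxE !ord1 /= /hd; congr (z _ _); exact/val_inj.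
have -> : (size S)%:R * (\prod_i `|U i i|) = (size [seq hd z | z <- S])%:R * (`|a| * D).
  rewrite size_map big_ord_recl -/a; congr (_ * (_ * _)).
  by apply: eq_bigr => i _; rewrite !mxE; congr `|U _ _|; exact/val_inj.
rewrite -(integral_cells c0 _ a0 D0).
apply: ge0_le_integralT => x; first by rewrite lee_fin mulr_ge0.
set t := (x - c0) / a; set k := Num.floor t.
rewrite mulrC count_map.
pose Sk := [seq tl z | z <- S & hd z == k].
have -> : count (preim hd (pred1 k)) S = size Sk by rewrite size_map size_filter.
apply: (IHn U' (c' + t *: b) Sk).
- move=> i j ij; rewrite !mxE; exact: Utri.
- rewrite map_inj_in_uniq ?filter_uniq// => z w; rewrite !mem_filter.
  by move=> /andP[/eqP zk _] /andP[/eqP wk _] tlE; rewrite (zE z) (zE w) zk wk tlE.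
- move=> z' u /mapP[z]; rewrite mem_filter => /andP[/eqP zk zS ->] u01 /=.
  pose v : 'rV[R]_(1 + n) := row_mx (t - k%:~R)%:M u.
  have v01 (j : 'I_(1 + n)) : 0 <= v 0 j < 1.
    case: (split_ordP j) => j' ->; rewrite ?row_mxEl ?row_mxEr//.
    rewrite mxE !ord1 eqxx mulr1n subr_ge0 floor_le/= ltrBlDr.
    by rewrite addrC -intrD1 floorD1_gt.
  suff <- : c + (map_mx intr z + v) *m U =
      row_mx x%:M (c' + t *: b + (map_mx intr (tl z) + u) *m U').
    exact: SA.
  rewrite cE {1}(zE z) zk -/U1 UE.
  rewrite (_ : map_mx intr _ =
      row_mx (k%:~R)%:M (map_mx intr (tl z)) :> 'rV[R]_(1 + n)); last first.
    by rewrite map_row_mx map_scalar_mx.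
  by apply: box_rowE; rewrite /t divfK// addrC subrK.
Qed.
End Vol.

(** * Volume and the number of lattice points *)

Section Shadow.
Context {R : realType}.

Definition floor_row n (x : 'rV[R]_n) : 'rV[int]_n :=
  \row_j Num.floor (x 0 j).

Lemma floor_row_frac n (x : 'rV[R]_n) j :
  0 <= (x - map_mx intr (floor_row x)) 0 j < 1.
Proof.
rewrite !mxE subr_ge0 floor_le/= ltrBlDr addrC -intrD1; exact: floorD1_gt.
Qed.

(** Coordinate j of y L is y_j plus a combination of the later coordinates of y,
    and the floor commutes with adding the integer y_j; so y can be recovered
    from the rounded vector, from the last coordinate down to the first. *)
Lemma unitriangular_floor_inj n (L : 'M[R]_n) :
  (forall i j : 'I_n, (i <= j)%N -> L i j = (i == j)%:R) ->
  injective (fun y : 'rV[int]_n => floor_row (map_mx intr y *m L)).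
Proof.
move=> Ltri y y' /rowP eqf; apply/rowP => j.
have [m] := ubnP (n - j)%N; elim: m j => // m IHm j; rewrite ltnS => jm.
have splitE (w : 'rV[int]_n) : (map_mx intr w *m L) 0 j =
    (w 0 j)%:~R + \sum_(i < n | (j < i)%N) (w 0 i)%:~R * L i j.
  rewrite mxE (bigD1 j)//= Ltri// eqxx mulr1 !mxE; congr (_ + _).
  rewrite (bigID (fun i : 'I_n => (j < i)%N))/= addrC big1 ?add0r.
    apply: eq_big => [i|i _]; last by rewrite mxE.
    by rewrite neq_ltn; case: (ltngtP i j).
  move=> i /andP[ij]; rewrite -leqNgt => ij'.
  by rewrite Ltri// (negbTE ij) mulr0.
have floorE w : floor_row w 0 j = Num.floor (w 0 j) by rewrite mxE.
have := eqf j; rewrite /= !floorE !splitE.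
rewrite (eq_bigr (fun i => (y' 0 i)%:~R * L i j)); last first.
  move=> i ji; rewrite IHm//; apply: leq_trans jm.
  by rewrite ltn_sub2l// (leq_trans ji)// ltnW.
by rewrite !floorDzr// ?intrKfloor ?qualifE//= => /addIr.
Qed.

(** The LUP decomposition replaces the lattice of B by that of a triangular
    matrix U, up to a bounded displacement: permuting coordinates preserves the
    integer vectors, and the shear L is replaced by its rounding, which is
    injective on them. *)
Lemma lattice_box_shadow n (B : 'M[R]_n) :
  exists (U : 'M[R]_n) (f : 'rV[int]_n -> 'rV[int]_n),
  [/\ forall i j : 'I_n, (j < i)%N -> U i j = 0,
      \prod_i `|U i i| = `|\det B|,
      injective f &
      forall z, exists2 e : 'rV[R]_n, (forall j, 0 <= e 0 j < 1) &
        map_mx intr z *m B = (map_mx intr (f z) + e) *m U].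
Proof.
case: n B => [|n] B.
  exists B, id; split => //; first by move=> [].
    by rewrite det_mx00 normr1 big_ord0.
  by move=> z; exists 0 => [[]//|]; rewrite addr0.
have /is_perm_mxP[s] := cormen_lup_perm B.
have := cormen_lup_correct B; have := cormen_lup_detL B.
have := @cormen_lup_lower _ _ B; have := @cormen_lup_upper _ _ B.
case: (cormen_lup B) => [[P L] U]/= Uup Llo detL PB Ps.
have PBLU : perm_mx s *m B = L *m U by rewrite -Ps.
have BE : B = perm_mx (s^-1)%g *m L *m U.
  by rewrite -mulmxA -PBLU mulmxA -perm_mxM mulVg perm_mx1 mul1mx.
exists U, (fun z => floor_row (map_mx intr (z *m perm_mx (s^-1)%g) *m L)); split => //.
- have -> : `|\det B| = `|\det U|.
    by rewrite BE !det_mulmx detL mulr1 normrM det_perm normrX normrN1 expr1n mul1r.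
  rewrite -det_tr det_trig ?normr_prod.
    by apply: eq_bigr => i _; rewrite mxE.
  by apply/is_trig_mxP => i j ij; rewrite mxE Uup.
- move=> z z' /(unitriangular_floor_inj Llo).
  by move/(can_inj (mulmxK (unitmx_perm _ _))).
- move=> z; set x := _ *m L.
  exists (x - map_mx intr (floor_row x)) => [j|]; first exact: floor_row_frac.
  by rewrite subrKC BE !mulmxA /x map_mxM map_perm_mx.
Qed.
End Shadow.

Section Body.
Context {R : realType} {n : nat} (K : set 'rV[R]_n).
Hypotheses (K_body : convex_body K) (K_sym : origin_symmetric K).

Lemma convex_body_comb x y (t : R) :
  0 <= t -> t <= 1 -> K x -> K y -> K (t *: x + (1 - t) *: y).
Proof.
move=> t0 t1 Kx Ky; case: K_body => _ Kconv _.
by have /= := Kconv x y (Itv01 t0 t1); rewrite !inE; apply.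
Qed.

(** With x0 + y and -(x0 - y) the body contains their midpoint y. *)
Lemma body_contains_cube :
  exists2 e : R, 0 < e & forall y : 'rV[R]_n, (forall j, `|y 0 j| < e) -> K y.
Proof.
case: K_body => _ _ [x0 /nbhs_ballP[e /= e0 xK]]; exists e => // y ye.
have Kx (z : 'rV[R]_n) : (forall j, `|z 0 j| < e) -> K (x0 + z).
  move=> ze; apply: xK; split=> // i j; rewrite ord1 /= /ball/= !mxE.
  by rewrite opprD addNKr normrN.
have half0 : 0 <= 2^-1 :> R by rewrite invr_ge0.
have half1 : 2^-1 <= 1 :> R by rewrite invf_le1 ?ler1n.
have Ky1 := Kx y ye.
have Ky2 : K (- (x0 - y)) by apply/K_sym; rewrite opprK; apply: Kx => j; rewrite mxE normrN.
have := convex_body_comb half0 half1 Ky1 Ky2.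
by congr (K _); apply/rowP => j; rewrite !mxE; field.
Qed.

Lemma body0 : K 0.
Proof. by have [e e0] := body_contains_cube; apply => j; rewrite mxE normr0. Qed.

(** The sum is a + b times a convex combination of two points of K. *)
Lemma dilateD a b x y : 0 <= a -> 0 <= b -> dilate a K x -> dilate b K y ->
  dilate (a + b) K (x + y).
Proof.
move=> a0 b0 [k Kk <-] [l Kl <-].
have [ab0|ab0] := eqVneq (a + b) 0.
  have [/eqP -> /eqP ->] : a == 0 /\ b == 0.
    by apply/andP; rewrite -paddr_eq0// ab0.
  by exists 0; [exact: body0|rewrite !scale0r !addr0 ?scaler0].
have ab_gt0 : 0 < a + b by rewrite lt_neqAle eq_sym ab0 addr_ge0.
exists (a / (a + b) *: k + (1 - a / (a + b)) *: l).
  apply: convex_body_comb => //; first by rewrite divr_ge0// ltW.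
  by rewrite ler_pdivrMr// mul1r lerDl.
rewrite scalerDr !scalerA; congr (_ *: _ + _ *: _); first by rewrite mulrC divfK.
by rewrite mulrBr mulr1 mulrC divfK// addrAC subrr add0r.
Qed.

Lemma dilate0 a : dilate a K 0.
Proof. by exists 0; [exact: body0|rewrite scaler0]. Qed.

Lemma dilateW a b : 0 <= a -> a <= b -> dilate a K `<=` dilate b K.
Proof.
move=> a0 ab x ax; rewrite -[b](subrKC a) -[x]addr0.
by apply: dilateD => //; [rewrite subr_ge0|exact: dilate0].
Qed.

Lemma dilateN a x : dilate a K x -> dilate a K (- x).
Proof.
by move=> [k Kk <-]; exists (- k); [apply/K_sym; rewrite opprK|rewrite scalerN].
Qed.

Lemma dilateZ a b x : dilate a K x -> dilate (b * a) K (b *: x).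
Proof. by move=> [k Kk <-]; exists k => //; rewrite scalerA. Qed.

Lemma dilate_normZ a b x : dilate a K x -> dilate (`|b| * a) K (b *: x).
Proof.
move=> ax; case: (ger0P b) => b0; first exact: dilateZ.
by rewrite -[_ *: x]opprK -scaleNr; apply/dilateN/dilateZ.
Qed.

Lemma dilate_cube_image (U : 'M[R]_n) : exists2 C : R, 0 < C &
  forall e : 'rV[R]_n, (forall j, `|e 0 j| <= 1) -> dilate C K (e *m U).
Proof.
have [d d0 dK] := body_contains_cube.
pose M := \sum_i \sum_j `|U i j| + 1.
have M0 : 0 < M by rewrite ltr_wpDl// sumr_ge0// => i _; rewrite sumr_ge0.
have C0 : 0 < M / d by rewrite divr_gt0.
exists (M / d) => // e e1.
exists ((M / d)^-1 *: (e *m U)); last by rewrite scalerA divff ?scale1r ?gt_eqF.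
apply: dK => j; rewrite mxE normrM gtr0_norm ?invr_gt0// invf_div mulrAC.
rewrite ltr_pdivrMr// ltr_pM2l// mxE.
apply: le_lt_trans (ler_norm_sum _ _ _) _.
rewrite /M ltr_pwDr// ler_sum// => i _.
rewrite normrM (bigD1 j)//=; apply: le_trans (ler_piMl _ (e1 i)) _ => //.
by rewrite lerDl sumr_ge0.
Qed.

(** Each lattice point of T K is traded for a box, all of which lies in
    (T + C) K where C absorbs both the displacement and the diameter of the
    box; after scaling by 1 / (T + C) the boxes lie in K. *)
Lemma vol_ge_lattice_count (B : 'M[R]_n) : exists2 C : R, 0 < C &
  forall (T : R) (X : seq 'rV[R]_n), 0 <= T -> uniq X ->
  (forall x, x \in X -> lattice B x /\ dilate T K x) ->
  (((size X)%:R * `|\det B| / (T + C) ^+ n)%:E <= vol K)%E.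
Proof.
have [U [f [Utri Udet f_inj fU]]] := lattice_box_shadow B.
have [C C0 CK] := dilate_cube_image U; exists C => // T X T0 Xuniq XP.
have TC0 : 0 < T + C by rewrite ltr_wpDl.
have [g gE] : {g : 'rV[R]_n -> 'rV[int]_n &
    forall x, lattice B x -> x = map_mx intr (g x) *m B}.
  apply: (@choice _ _ (fun x z => lattice B x -> x = map_mx intr z *m B)) => x.
  by have [[z _ <-]|nx] := pselect (lattice B x); [exists z|exists 0].
pose S := [seq f (g x) | x <- X].
have -> : (size X)%:R * `|\det B| / (T + C) ^+ n =
    (size S)%:R * \prod_i `|((T + C)^-1 *: U) i i|.
  rewrite size_map -Udet -mulrA; congr (_ * _).
  under [RHS]eq_bigr do rewrite mxE normrM gtr0_norm ?invr_gt0//.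
  by rewrite big_split/= prodr_const card_ord exprVn mulrC.
apply: (@vol_ge_boxes _ _ _ 0).
- by move=> i j ij; rewrite mxE Utri// mulr0.
- rewrite map_inj_in_uniq// => x y /XP[Lx _] /XP[Ly _] /f_inj gxy.
  by rewrite (gE x)// (gE y)// gxy.
- move=> _ u /mapP[x /XP[Lx Tx] ->] u01; have [e e01] := fU (g x).
  rewrite -(gE x)// add0r => xE.
  have: dilate (T + C) K (x + (u - e) *m U).
    apply: dilateD => //; first exact: ltW.
    apply: CK => j; rewrite !mxE ler_norml lerBlDr lerBrDr.
    by have /andP[? ?] := u01 j; have /andP[? ?] := e01 j; lra.
  move=> [k Kk kE]; rewrite -scalemxAr (_ : _ *m U = (T + C) *: k).
    by rewrite scalerA mulVf ?scale1r ?gt_eqF.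
  by rewrite kE [in RHS]xE -mulmxDl addrACA subrr addr0.
Qed.

End Body.

(** * Counting by fibres, and power sums *)

Section Counting.
Context {R : realType}.

(** A lower bound for the number of elements of A that makes sense whether or
    not A is finite; the bound is real because the counts are compared with
    polynomials in a real variable. *)
Definition count_ge (T : eqType) (A : set T) (c : R) :=
  exists X : seq T, [/\ uniq X, forall x, x \in X -> A x & c <= (size X)%:R].

Lemma count_geW (T : eqType) (A B : set T) (c d : R) :
  A `<=` B -> d <= c -> count_ge A c -> count_ge B d.
Proof.
move=> AB dc [X [Xu XA cX]]; exists X; split=> //; last exact: le_trans cX.
by move=> x /XA; exact: AB.
Qed.

Lemma sum_ltn_leq_min M k : (\sum_(b < M) (b < k) <= minn M k)%N.
Proof.
elim: M => [|M IHM]; first by rewrite big_ord0.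
by rewrite big_ord_recr/=; move: IHM; case: (ltnP M k) => /=; lia.
Qed.

(** A double count.  Let lev x be the number of the sets A b that contain x.  The
    sets are nested, so x lies in A (lev x - 1) and has at least 2 lev x points
    above it.  Summing lev x over x and exchanging the sums counts each
    A b once. *)
Lemma count_ge_fibration (T T' : eqType) (cl : T' -> T) (E : set T')
    (A : nat -> set T) (c : nat -> R) (M : nat) :
  (forall b b', (b <= b' < M)%N -> A b' `<=` A b) ->
  (forall b, (b < M)%N -> count_ge (A b) (c b)) ->
  (forall b x, (b < M)%N -> A b x ->
     count_ge (E `&` cl @^-1` [set x]) (2 * b.+1)%:R) ->
  count_ge E (2 * \sum_(b < M) c b).
Proof.
move=> Anest Acount fib.
have [S SP] : {S : nat -> seq T & forall b, (b < M)%N ->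
    [/\ uniq (S b), forall x, x \in S b -> A b x & c b <= (size (S b))%:R]}.
  apply: (@choice _ _ (fun b X => (b < M)%N -> [/\ uniq X,
    forall x, x \in X -> A b x & c b <= (size X)%:R])) => b.
  by case: (ltnP b M) => [/Acount[X XP]|_]; [exists X|exists [::]].
pose lev x := (\sum_(b < M) `[< A b x >])%N.
have levP x : (0 < lev x)%N -> exists2 b, (b < M)%N & A b x /\ lev x = b.+1.
  move=> lev_gt0; exists (lev x).-1.
    rewrite prednK//; apply: leq_trans (_ : \sum_(b < M) 1 <= M)%N.
      by apply: leq_sum => b _; exact: leq_b1.
    by rewrite sum1_card card_ord.
  split; last by rewrite prednK.
  apply: contrapT => nA.
  suff : (lev x <= (lev x).-1)%N by rewrite leqNgt prednK// leqnn.
  rewrite {1}/lev; apply: leq_trans (_ : \sum_(b < M) (b < (lev x).-1) <= _)%N.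
    apply: leq_sum => b _; case: asboolP => // Abx.
    rewrite lt0b ltnNge; apply/negP => lb; apply: nA.
    by apply: (Anest _ b); rewrite // lb/=.
  by apply: leq_trans (sum_ltn_leq_min M _) (geq_minr _ _).
have [F FP] : {F : T -> seq T' & forall x, [/\ uniq (F x),
    forall y, y \in F x -> E y /\ cl y = x & (2 * lev x <= size (F x))%N]}.
  apply: (@choice _ _ (fun x Y => [/\ uniq Y,
    forall y, y \in Y -> E y /\ cl y = x & (2 * lev x <= size Y)%N])) => x.
  have [/eqP lev0|/levP[b bM [Abx ->]]] := posnP (lev x).
    by exists [::]; rewrite (eqP lev0).
  by have [Y [Yu YE Ys]] := fib b x bM Abx; exists Y; split=> //; rewrite -(ler_nat R).
pose X := undup (flatten [seq S b | b <- iota 0 M]).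
exists [seq y | x <- X, y <- F x]; split.
- apply: allpairs_uniq_dep; rewrite ?undup_uniq//.
    by move=> x _; case: (FP x).
  move=> _ _ /allpairsPdep[x [y [_ yF ->]]] /allpairsPdep[x' [y' [_ yF' ->]]] /= yy'.
  have [_ /(_ _ yF)[_ <-] _] := FP x; have [_ /(_ _ yF')[_ <-] _] := FP x'.
  by rewrite yy'.
- by move=> _ /allpairsPdep[x [y [_ yF ->]]]; have [_ /(_ _ yF)[]] := FP x.
rewrite size_allpairs_dep sumnE big_map.
apply: (@le_trans _ _ (\sum_(x <- X) (2 * lev x))%N%:R); last first.
  by rewrite ler_nat; apply: leq_sum => x _; case: (FP x).
rewrite -big_distrr/= natrM ler_pM2l// exchange_big/= natr_sum.
apply: ler_sum => b _; have [Su SA cS] := SP b (ltn_ord b).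
apply: le_trans cS _; rewrite ler_nat.
have -> : (\sum_(x <- X) `[< A b x >])%N = count (fun x => `[< A b x >]) X.
  by rewrite -sum1_count [RHS]big_mkcond; apply: eq_bigr => x _; case: asboolP.
rewrite -size_filter; apply: uniq_leq_size => // x xS.
rewrite mem_filter; apply/andP; split; first exact/asboolP/SA.
rewrite mem_undup; apply/flatten_mapP; exists (val b) => //.
by rewrite mem_iota add0n ltn_ord.
Qed.

(** The tangent to the (p + 1)-st power at x lies below its graph. *)
Lemma bernoulli_sub (x l : R) p : 0 <= l -> l <= x ->
  x ^+ p.+1 - p.+1%:R * l * x ^+ p <= (x - l) ^+ p.+1.
Proof.
move=> l0 lx; have x0 : 0 <= x := le_trans l0 lx.
elim: p => [|p IHp]; first by rewrite !expr1 expr0 mulr1 mul1r.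
rewrite [leRHS]exprS; apply: le_trans (ler_wpM2l _ IHp); last by rewrite subr_ge0.
have xp0 : 0 <= x ^+ p by rewrite exprn_ge0.
rewrite -subr_ge0 !exprS -!natr1; set X := x ^+ p in xp0 *.
rewrite [leRHS](_ : _ = (p%:R + 1) * l * l * X); last by ring.
by rewrite !mulr_ge0// addr_ge0.
Qed.

(** A lower Riemann-type bound: by [bernoulli_sub] each term
    (p + 1) l (x - l b)^p dominates the increment of the (p + 1)-st power from
    x - l (b + 1) to x - l b, and these increments telescope; the last term
    dominates (x - l M)^(p + 1) because x - l M < l. *)
Lemma power_sum_ge p (l : R) M x : 0 < l -> M%:R * l <= x -> x < M.+1%:R * l ->
  x ^+ p.+1 / (l * p.+1%:R) <= \sum_(b < M.+1) (x - l * b%:R) ^+ p.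
Proof.
move=> l0; rewrite ler_pdivrMr ?mulr_gt0//.
elim: M x => [|M IHM] x.
  rewrite mul0r !mul1r big_ord1 mulr0 subr0 exprSr => x0 xl.
  by rewrite ler_wpM2l ?exprn_ge0// (le_trans (ltW xl))// ler_peMr ?ler1n ?ltW.
move=> lo hi.
have lx : l <= x.
  by apply: le_trans lo; rewrite (ler_peMl (ltW l0))// ler1n.
have := IHM (x - l); rewrite lerBrDr ltrBlDr.
rewrite -[X in _ + X <= x]mul1r -[X in _ < _ + X]mul1r -!mulrDl !natr1.
move=> /(_ lo hi) IH.
rewrite big_ord_recl mulr0 subr0 mulrDl.
have := bernoulli_sub p (ltW l0) lx; rewrite lerBlDr => /le_trans; apply.
rewrite addrC; apply: lerD; first by rewrite mulrC (mulrC l).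
apply: le_trans IH _; rewrite le_eqVlt; apply/orP; left; apply/eqP; congr (_ * _).
apply: eq_bigr => b _; congr (_ ^+ _).
by rewrite /= /bump/= add1n -natr1 mulrDr mulr1; ring.
Qed.

End Counting.

(** * Lattice points modulo a subspace *)

Section Proj.
Context {R : realType} {n : nat}.
Implicit Types (W : {vspace 'rV[R]_n}) (x y : 'rV[R]_n).

Lemma proj_compl_eq0 W x : (proj_compl W x == 0) = (x \in W).
Proof.
have [pW xpW] := proj_complP W x; apply/eqP/idP => [p0|xW].
  by move: xpW; rewrite p0 subr0.
have : proj_compl W x \in (orth_compl W :&: W)%VS.
  rewrite memv_cap pW/=.
  by have := memvB xW xpW; rewrite opprB subrKC.
by rewrite orth_compl_disjoint memv0 => /eqP.
Qed.

Lemma proj_compl_eqP W x y :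
  reflect (proj_compl W x = proj_compl W y) (x - y \in W).
Proof. by rewrite -proj_compl_eq0 linearB subr_eq0; exact: eqP. Qed.

Lemma proj_compl_id0 x : proj_compl 0%VS x = x.
Proof.
by have [_] := proj_complP 0%VS x; rewrite memv0 subr_eq0 => /eqP.
Qed.

Lemma proj_compl_comp W' W x : (W' <= W)%VS ->
  proj_compl W (proj_compl W' x) = proj_compl W x.
Proof.
move=> /subvP sW; apply/esym/proj_compl_eqP/sW.
by have [] := proj_complP W' x.
Qed.
End Proj.

Section Lattice.
Context {R : realType} {n : nat}.

Lemma lattice_comb (B : 'M[R]_n) x y (a : int) :
  lattice B x -> lattice B y -> lattice B (x + a%:~R *: y).
Proof.
move=> [z _ <-] [w _ <-]; exists (z + a *: w) => //.
by rewrite map_mxD map_mxZ mulmxDl scalemxAl.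
Qed.

(** Two lattice points have the same projection exactly when they agree modulo W
    ([proj_compl_eqP]), so projections are canonical labels for classes modulo
    W. *)
Definition proj_lattice_points (K : set 'rV[R]_n) (B : 'M[R]_n) W (T : R) :=
  (proj_compl W @` lattice B) `&` (proj_compl W @` dilate T K).

End Lattice.

Section Step.
Context {R : realType} {n : nat} (K : set 'rV[R]_n) (B : 'M[R]_n).
Hypotheses (K_body : convex_body K) (K_sym : origin_symmetric K).

Local Notation PP := (proj_lattice_points K B).

Lemma proj_lattice_pointsW W a b : 0 <= a -> a <= b -> PP W a `<=` PP W b.
Proof.
move=> a0 ab y [yL [x xa xy]]; split=> //; exists x => //.
exact: (dilateW K_body K_sym a0 ab).
Qed.

(** Write a representative of the class y as x = k + s v + w with k in
    (T - l (b + 1)) K and w in W'.  For an integer a the vector x + a v is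
    congruent to k + (s + a) v modulo W', which lies in T K as soon as
    |s + a| <= b + 1; exactly 2 (b + 1) consecutive integers a are used. *)
Lemma count_fibre (W' : {vspace 'rV[R]_n}) v (l T : R) b y :
  lattice B v -> 0 < l -> dilate l K v -> v \notin W' ->
  0 <= T - l * b.+1%:R -> PP (<[v]> + W')%VS (T - l * b.+1%:R) y ->
  count_ge (PP W' T `&` proj_compl (<[v]> + W')%VS @^-1` [set y])
    ((2 * b.+1)%:R : R).
Proof.
set W := (_ + _)%VS => vL l0 lv vW' T0 [[x xL xy] [k kT ky]].
have : x - k \in W by apply/proj_compl_eqP; rewrite xy ky.
move=> /memv_addP[_ /vlineP[s ->] [w wW' xk]].
(* then s + a i is the fractional part of s plus i - (b + 1) *)
pose a (i : nat) : int := i%:Z - b.+1%:Z - Num.floor s.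
pose g i : 'rV[R]_n := proj_compl W' (x + (a i)%:~R *: v).
have gE i : g i = proj_compl W' (k + (s + (a i)%:~R) *: v).
  rewrite /g; apply/proj_compl_eqP.
  rewrite (_ : _ - _ = w)// -[x](subrKC k) xk.
  by apply/rowP => j; rewrite !mxE; ring.
exists [seq g i | i <- iota 0 (2 * b.+1)]; split.
- rewrite map_inj_uniq ?iota_uniq// => i j /proj_compl_eqP.
  rewrite opprD addrACA subrr add0r -scalerBl rpredZeq (negbTE vW') orbF.
  by rewrite -rmorphB/= intr_eq0 subr_eq0 /a => /eqP; lia.
- move=> _ /mapP[i + ->]; rewrite mem_iota add0n => /andP[_ ib].
  split; last first.
    rewrite /= proj_compl_comp ?addvSr// -xy; apply/proj_compl_eqP.
    by rewrite addrAC subrr add0r memvZ// (subvP (addvSl _ _))// memv_line.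
  split; first by exists (x + (a i)%:~R *: v) => //; exact: lattice_comb.
  exists (k + (s + (a i)%:~R) *: v); last by rewrite gE.
  apply: (dilateW K_body K_sym (a := T - l * b.+1%:R + `|s + (a i)%:~R| * l)).
    by rewrite addr_ge0// mulr_ge0// ltW.
    suff : `|s + (a i)%:~R| <= b.+1%:R.
      by rewrite -(ler_pM2r l0) => h; rewrite addrAC lerBlDr lerD2l [l * _]mulrC.
    rewrite /a !rmorphB/= ler_norml.
    have := floor_le s; have := floorD1_gt s; rewrite intrD1.
    have : i%:R <= 2 * b.+1%:R - 1 :> R.
      by rewrite lerBrDr natr1 -natrM ler_nat.
    have : 0 <= i%:R :> R by [].
    move=> i0 i1 f1 f2; rewrite !pmulrn; apply/andP; split; lra.
  apply: dilateD => //; first by rewrite mulr_ge0// ltW.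
  exact: dilate_normZ.
- by rewrite size_map size_iota.
Qed.
End Step.

(** * Growth of the number of projected lattice points *)

Section Iterate.
Context {R : realType} {n : nat} (K : set 'rV[R]_n) (B : 'M[R]_n).
Hypotheses (K_body : convex_body K) (K_sym : origin_symmetric K).

Local Notation PP := (proj_lattice_points K B).

(** The shift k makes the lower bound valid for every T >= k, so that no error
    terms have to be carried through the induction over the v_i. *)
Definition count_growth W (c k : R) (p : nat) :=
  forall T, k <= T -> count_ge (PP W T) (c * (T - k) ^+ p).

(** [count_ge_fibration] with A b the classes modulo W at level T - l (b + 1); the
    number of admissible levels b is the integer part of (T - k) / l, and
    [power_sum_ge] evaluates the resulting sum. *)
Lemma count_growth_step (W' : {vspace 'rV[R]_n}) v (l c k : R) p :
  lattice B v -> 0 < l -> dilate l K v -> v \notin W' -> 0 <= c -> 0 <= k ->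
  count_growth (<[v]> + W')%VS c k p ->
  count_growth W' (2 * c / (l * p.+1%:R)) (k + l) p.+1.
Proof.
move=> vL l0 lv vW' c0 k0 cW T kT.
have lY : l <= T - k by rewrite lerBrDr addrC.
have [M loM hiM] : exists2 M, M%:R * l <= T - k - l & T - k - l < M.+1%:R * l.
  exists (Num.truncn ((T - k - l) / l)).
    by rewrite -ler_pdivlMr// truncn_le// divr_ge0 ?subr_ge0// ltW.
  by rewrite -ltr_pdivrMr// truncnS_gt.
have leb b : (b < M.+1)%N -> k <= T - l * b.+1%:R.
  rewrite ltnS -(ler_nat R) -(ler_pM2r l0) => bM.
  by rewrite -natr1 mulrDr mulr1 mulrC; lra.
apply: (@count_geW _ _ (PP W' T) _ (2 * \sum_(b < M.+1) c * (T - l * b.+1%:R - k) ^+ p)).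
- by [].
- rewrite -mulr_sumr.
  have -> : 2 * c / (l * p.+1%:R) * (T - (k + l)) ^+ p.+1 =
      2 * (c * ((T - k - l) ^+ p.+1 / (l * p.+1%:R))).
    by rewrite opprD addrA -!mulrA [_^-1 * _]mulrC.
  rewrite ler_pM2l// ler_wpM2l//.
  have /le_trans := power_sum_ge p l0 loM hiM; apply.
  rewrite le_eqVlt; apply/orP; left; apply/eqP/eq_bigr => b _; congr (_ ^+ _).
  by rewrite -natr1; ring.
apply: (@count_ge_fibration _ _ _ (proj_compl (<[v]> + W')%VS) _
  (fun b => PP (<[v]> + W')%VS (T - l * b.+1%:R))
  (fun b => c * (T - l * b.+1%:R - k) ^+ p)).
- move=> b b' /andP[bb' b'M]; apply: proj_lattice_pointsW => //.
    by rewrite (le_trans k0)// leb.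
  by rewrite lerD2l lerN2 ler_pM2l// ler_nat.
- by move=> b bM; apply: cW; exact: leb.
- move=> b y bM; apply: count_fibre => //.
  by rewrite (le_trans k0)// leb.
Qed.

(** Each step multiplies the constant by 2 / l and divides it by the new exponent;
    the latter divisors accumulate to (p + size s)! / p!. *)
Lemma count_growth_iter (s : seq ('rV[R]_n * R)) c k p :
  free [seq vl.1 | vl <- s] ->
  (forall vl, vl \in s -> [/\ lattice B vl.1, 0 < vl.2 & dilate vl.2 K vl.1]) ->
  0 <= c -> 0 <= k ->
  count_growth <<[seq vl.1 | vl <- s]>>%VS c k p ->
  exists2 k', 0 <= k' &
    count_growth 0%VS
      (c * (2 ^+ size s * p`!%:R / (p + size s)`!%:R / \prod_(vl <- s) vl.2))
      k' (p + size s).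
Proof.
elim: s c k p => [|[v l] s IHs] c k p /=.
  rewrite span_nil addn0 expr0 mul1r big_nil divr1 divff ?mulr1.
    by move=> _ _ c0 k0 cW; exists k.
  by rewrite pnatr_eq0 -lt0n fact_gt0.
rewrite free_cons => /andP[vs sfree] sP c0 k0.
have [vL l0 lv] := sP _ (mem_head _ _).
rewrite /= in vL l0 lv.
rewrite span_cons => /(count_growth_step vL l0 lv vs c0 k0) cW.
have {}sP vl : vl \in s -> [/\ lattice B vl.1, 0 < vl.2 & dilate vl.2 K vl.1].
  by move=> vls; apply: sP; rewrite inE vls orbT.
have c'0 : 0 <= 2 * c / (l * p.+1%:R).
  by rewrite divr_ge0 ?mulr_ge0// ltW.
have [k' k'0 cW'] := IHs _ _ _ sfree sP c'0 (addr_ge0 k0 (ltW l0)) cW.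
exists k' => //; rewrite addnS -addSn; move: cW'; congr count_growth.
have P0 : \prod_(vl <- s) vl.2 != 0.
  by rewrite prodf_seq_neq0; apply/allP => vl /sP[_ ? _]; rewrite gt_eqF.
rewrite big_cons/= factS natrM exprS; field.
by rewrite P0 (gt_eqF l0) !pnatr_eq0 -lt0n fact_gt0/=.
Qed.

End Iterate.

Section Base.
Context {R : realType} {n : nat} (K : set 'rV[R]_n) (B : 'M[R]_n).
Hypotheses (K_body : convex_body K) (K_sym : origin_symmetric K).
Hypothesis B_inv : B \in unitmx.

Local Notation PP := (proj_lattice_points K B).

(** By the Smith normal form V = M D Q the rows of V are combinations of the first
    r rows of Q.  So in the lattice basis given by Q the remaining coordinates
    vanish on the span of v, and lattice vectors that differ in one of them are
    distinct modulo this span. *)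
Lemma lattice_span_coords r (V : 'M[int]_(r, n)) (v : r.-tuple 'rV[R]_n) :
  (forall i, tnth v i = map_mx intr (row i V) *m B) ->
  exists2 Q : 'M[int]_n, Q \in unitmx &
    forall (u : 'rV[int]_n), map_mx intr u *m B \in <<v>>%VS ->
    forall j : 'I_n, (r <= j)%N -> (u *m invmx Q) 0 j = 0.
Proof.
move=> vE; have [L _ [Q Qu [d _ VE]]] := int_Smith_normal_form V.
exists Q => // u uv j rj.
pose q (x : 'rV[R]_n) := (x *m invmx B *m map_mx intr (invmx Q)) 0 j.
have q_lat (w : 'rV[int]_n) : q (map_mx intr w *m B) = ((w *m invmx Q) 0 j)%:~R.
  by rewrite /q mulmxK// -map_mxM mxE.
suff : q (map_mx intr u *m B) = 0 by rewrite q_lat => /eqP; rewrite intr_eq0 => /eqP.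
rewrite (coord_span uv) /q mulmx_suml mulmx_suml summxE big1// => i _.
rewrite -scalemxAl -scalemxAl mxE -tnth_nth vE.
rewrite -[X in _ * X]/(q _) q_lat VE row_mul mulmxK// row_mul mxE.
rewrite big1 ?mulr0// => k _; rewrite !mxE.
have -> : (k == j :> nat) = false by rewrite ltn_eqF// (leq_trans (ltn_ord k)).
by rewrite mulr0n mulr0.
Qed.

Lemma card_ord_ge r : #|[pred j : 'I_n | (r <= j)%N]| = (n - r)%N.
Proof.
rewrite -sum1_card -(big_geq_mkord r n xpredT (fun=> 1%N)) sum_nat_const_nat.
by rewrite muln1.
Qed.

(** In the basis Q of [lattice_span_coords] take the vectors c with the first r
    coordinates zero and the others in {0, ..., N}.  The covering property at
    c / (N + 1) provides a lattice vector z for which c - (N + 1) z projects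
    into m (N + 1) pi(K).  Different c give different projections because their
    last coordinates already differ modulo N + 1. *)
Lemma count_ge_covering r (v : r.-tuple 'rV[R]_n) (m : R) (N : nat) :
  (forall i, lattice B (tnth v i)) -> 0 < m ->
  Defs.minkowski (dilate m (proj_compl <<v>> @` K)) (proj_compl <<v>> @` lattice B)
    = [set` orth_compl <<v>>%VS] ->
  count_ge (PP <<v>>%VS (m * N.+1%:R)) (N.+1%:R ^+ (n - r) : R).
Proof.
move=> vL m0 cover.
have [V VE] : {V : 'I_r -> 'rV[int]_n & forall i, tnth v i = map_mx intr (V i) *m B}.
  apply: (@choice _ _ (fun i z => tnth v i = map_mx intr z *m B)) => i.
  by have [z _ <-] := vL i; exists z.
have [Q Qu spanQ] := @lattice_span_coords r (\matrix_i V i) v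
  (fun i => eq_trans (VE i) (congr1 (fun w => map_mx intr w *m B) (esym (rowK V i)))).
pose ci (c : {ffun 'I_n -> 'I_N.+1}) : 'rV[int]_n := \row_j (c j : nat)%:Z.
pose pt c z : 'rV[R]_n := map_mx intr (ci c *m Q - N.+1%:Z *: z) *m B.
have [g gP] : {g : {ffun 'I_n -> 'I_N.+1} -> 'rV[int]_n &
    forall c, PP <<v>>%VS (m * N.+1%:R) (proj_compl <<v>>%VS (pt c (g c)))}.
  apply: (@choice _ _ (fun c z => PP <<v>>%VS (m * N.+1%:R)
     (proj_compl <<v>>%VS (pt c z)))) => c.
  pose x : 'rV[R]_n := N.+1%:R^-1 *: (map_mx intr (ci c *m Q) *m B).
  have : [set` orth_compl <<v>>%VS] (proj_compl <<v>>%VS x).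
    by have [] := proj_complP <<v>>%VS x.
  rewrite -cover => -[_ [_ [k Kk <-] <-] [_ [_ [z _ <-] <-] xE]].
  exists z; split; first by exists (pt c z) => //; exists (ci c *m Q - N.+1%:Z *: z).
  exists ((m * N.+1%:R) *: k); first by exists k.
  rewrite /pt map_mxB map_mxZ mulmxBl -scalemxAl linearB/= !linearZ/=.
  have N0 : N.+1%:R != 0 :> R by [].
  rewrite -[map_mx intr (ci c *m Q) *m B](scalerKV N0) -/x linearZ/= -xE.
  by rewrite scalerDr scalerN addrK scalerA mulrC.
(* residues below N.+1 that are congruent modulo N.+1 coincide *)
have Nk (a b : 'I_N.+1) (w : int) : (a : nat)%:Z - (b : nat)%:Z = N.+1%:Z * w -> a = b.
  move=> h; apply/val_inj => /=; have := ltn_ord a; have := ltn_ord b.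
  by move=> ? ?; have [w0|w0] := eqVneq w 0; nia.
pose C := pffun_on ord0 [pred j : 'I_n | (r <= j)%N] (@predT 'I_N.+1).
exists [seq proj_compl <<v>>%VS (pt c (g c)) | c <- enum C]; split.
- rewrite map_inj_in_uniq ?enum_uniq// => c c'; rewrite !mem_enum.
  move=> /pffun_onP[cD _] /pffun_onP[c'D _] /proj_compl_eqP.
  rewrite /pt -mulmxBl -map_mxB => /spanQ eqj; apply/ffunP => j.
  case: (leqP r j) => [rj|jr].
    have := eqj j rj.
    rewrite (_ : _ - (_ - _) = (ci c - ci c') *m Q - N.+1%:Z *: (g c - g c')).
      rewrite mulmxBl mulmxK// -scalemxAl !mxE => /eqP; rewrite subr_eq0 => /eqP.
      exact: Nk.
    by rewrite mulmxBl scalerBr !opprD !opprK addrACA.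
  have c0 (f : {ffun 'I_n -> 'I_N.+1}) :
      {subset ord0.-support f <= [pred j : 'I_n | (r <= j)%N]} -> f j = ord0.
    move=> /(_ j) fD; apply/eqP; apply: contraTT jr => fj; rewrite -leqNgt.
    by apply: fD; rewrite inE.
  by rewrite !c0//; exact/fintype.subsetP.
- by move=> _ /mapP[c _ ->]; exact: gP.
- by rewrite size_map -cardE card_pffun_on card_ord_ge card_ord natrX.
Qed.

(** [count_ge_covering] at the integer part of T / m. *)
Lemma count_growth_covering r (v : r.-tuple 'rV[R]_n) (m : R) :
  (forall i, lattice B (tnth v i)) -> 0 < m ->
  Defs.minkowski (dilate m (proj_compl <<v>> @` K)) (proj_compl <<v>> @` lattice B)
    = [set` orth_compl <<v>>%VS] ->
  count_growth K B <<v>>%VS (m ^- (n - r)) m (n - r).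
Proof.
move=> vL m0 cover T mT.
have T0 : 0 <= T := le_trans (ltW m0) mT.
have Tm1 : 1 <= T / m by rewrite ler_pdivlMr// mul1r.
have := truncn_ge_nat 1 (divr_ge0 T0 (ltW m0)); rewrite Tm1.
case E : (Num.truncn (T / m)) => [//|N] _.
have [lo hi] : N.+1%:R <= T / m /\ T / m < N.+2%:R.
  rewrite -E; split; first by rewrite truncn_le// divr_ge0// ltW.
  exact: truncnS_gt.
apply: count_geW (count_ge_covering N vL m0 cover).
  apply: proj_lattice_pointsW => //; first by rewrite mulr_ge0// ltW.
  by rewrite mulrC -ler_pdivlMr.
rewrite -exprVn -exprMn lerXn2r ?nnegrE ?ler0n//.
  by rewrite mulr_ge0 ?invr_ge0 ?subr_ge0// ltW.
rewrite mulrC ler_pdivrMr// lerBlDr.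
by move: hi; rewrite ltr_pdivrMr// -natr1 mulrDl mul1r => /ltW.
Qed.
End Base.

(** * The limit, the covering radius and the theorem *)

Section Final.
Context {R : realType} {n : nat} (K : set 'rV[R]_n) (B : 'M[R]_n).
Hypotheses (K_body : convex_body K) (K_sym : origin_symmetric K).
Hypothesis B_inv : B \in unitmx.

(** The quotient (T - k) / (T + C) tends to 1.  By [bernoulli_sub] its p-th power
    is at least 1 - p (k + C) / (T + C), so an explicit T refutes V < a. *)
Lemma ratio_limit_le (a V k C : R) p : 0 <= a -> 0 <= k -> 0 < C ->
  (forall T, k <= T -> a * ((T - k) / (T + C)) ^+ p <= V) -> a <= V.
Proof.
move=> a0 k0 C0; case: p => [|p] aV.
  by have := aV _ (lexx _); rewrite expr0 mulr1.
rewrite leNgt; apply/negP => Va.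
have aV0 : 0 < a - V by rewrite subr_gt0.
pose u := a * p.+1%:R * (k + C).
have kC0 : 0 < k + C by rewrite ltr_wpDl.
have u0 : 0 <= u by rewrite !mulr_ge0// ltW.
pose T := k + u / (a - V).
have kT : k <= T by rewrite lerDl divr_ge0// ltW.
have TC0 : 0 < T + C by rewrite ltr_wpDl// (le_trans k0).
have := aV T kT; rewrite leNgt => /negP; apply.
pose l := (k + C) / (T + C).
have l0 : 0 <= l by rewrite divr_ge0 ?ltW.
have l1 : l <= 1 by rewrite ler_pdivrMr// mul1r lerD2r.
rewrite (_ : (T - k) / (T + C) = 1 - l); last first.
  by rewrite /l; field; rewrite gt_eqF.
apply: (@lt_le_trans _ _ (a * (1 - p.+1%:R * l))); last first.
  by rewrite ler_wpM2l//; have := bernoulli_sub p l0 l1; rewrite !expr1n mulr1.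
rewrite mulrBr mulr1 ltrBrDr -ltrBrDl mulrA /l mulrA ltr_pdivrMr// -/u.
have -> : (a - V) * (T + C) = u + (a - V) * (k + C).
  by rewrite /T addrAC mulrDr mulrC [(a - V) * (u / _)]mulrC divfK ?gt_eqF//; ring.
by rewrite ltrDl mulr_gt0.
Qed.

(** Rounding the coordinates of y in the lattice basis leaves a remainder in a
    fixed dilate of K.  The infimum of the empty set is 0 by convention, so the
    set defining the covering radius has to be shown nonempty. *)
Lemma covering_exists (L : {vspace 'rV[R]_n}) : exists m : R, 0 < m /\
  Defs.minkowski (dilate m (proj_compl L @` K)) (proj_compl L @` lattice B)
    = [set` orth_compl L].
Proof.
have [C C0 CK] := dilate_cube_image K_body K_sym B; exists C; split => //.
apply/seteqP; split => [_ [_ [_ [k _ <-] <-] [_ [x _ <-] <-]]|y yL] /=.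
  have [pk _] := proj_complP L k; have [px _] := proj_complP L x.
  by rewrite memvD ?memvZ.
pose z := floor_row (y *m invmx B).
have [k Kk kE] : dilate C K ((y *m invmx B - map_mx intr z) *m B).
  apply: CK => j; have /andP[lo hi] := floor_row_frac (y *m invmx B) j.
  by rewrite ger0_norm// ltW.
have yE : y = proj_compl L y.
  apply/eqP; rewrite -subr_eq0 -memv0 -(orth_compl_disjoint L) memv_cap.
  by have [pL ypL] := proj_complP L y; rewrite ypL memvB.
exists (C *: proj_compl L k).
  by exists (proj_compl L k) => //; exists k.
exists (proj_compl L (map_mx intr z *m B)).
  by exists (map_mx intr z *m B) => //; exists z.
by rewrite yE -linearZ/= kE -linearD/= -mulmxDl subrK mulmxKV.
Qed.

(** The inequality for one covering factor m, by comparing the two asymptotic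
    bounds for the number of lattice points of T K. *)
Lemma minima_product_covering_ge r (v : r.-tuple 'rV[R]_n) (l : 'I_r -> R) (m : R) :
  (r <= n)%N ->
  (forall i, lattice B (tnth v i)) -> free v ->
  (forall i, 0 < l i /\ dilate (l i) K (tnth v i)) -> 0 < m ->
  Defs.minkowski (dilate m (proj_compl <<v>> @` K)) (proj_compl <<v>> @` lattice B)
    = [set` orth_compl <<v>>%VS] ->
  ((2 ^+ r * (n - r)`!%:R / n`!%:R * `|\det B| /
     ((\prod_i l i) * m ^+ (n - r)))%:E <= vol K)%E.
Proof.
move=> rn vL vfree lP m0 cover.
pose s := [seq (tnth v i, l i) | i <- enum 'I_r].
have sv : [seq vl.1 | vl <- s] = v by rewrite -map_comp -[RHS]map_tnth_enum.
have ss : size s = r by rewrite size_map size_enum_ord.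
have sl : \prod_(vl <- s) vl.2 = \prod_i l i by rewrite big_map big_enum.
have prod0 : 0 < \prod_i l i by apply: prodr_gt0 => i _; case: (lP i).
have md0 : 0 < m ^+ (n - r) by rewrite exprn_gt0.
have growth0 := count_growth_covering K_body K_sym B_inv vL m0 cover.
have sfree : free [seq vl.1 | vl <- s] by rewrite sv.
have sP vl : vl \in s -> [/\ lattice B vl.1, 0 < vl.2 & dilate vl.2 K vl.1].
  by move=> /mapP[i _ ->]; have [] := lP i; split; first exact: vL.
have m_inv0 : 0 <= m ^- (n - r) by rewrite invr_ge0 ltW.
rewrite -sv in growth0.
have [k k0] := count_growth_iter K_body K_sym sfree sP m_inv0 (ltW m0) growth0.
rewrite sl ss subnK// => growth.
have [C C0 volC] := vol_ge_lattice_count K_body K_sym B.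
have [->|volfin] := eqVneq (vol K) +oo%E; first exact: leey.
have volE : (fine (vol K))%:E = vol K.
  by rewrite fineK// ge0_fin_numE ?vol_ge0// lt_neqAle volfin leey.
rewrite -volE lee_fin.
apply: (@ratio_limit_le _ _ k C n) => //.
  by rewrite !mulr_ge0 ?invr_ge0 ?mulr_ge0// ?exprn_ge0// ltW.
move=> T kT; have T0 : 0 <= T := le_trans k0 kT.
have [X [Xu XP cX]] := growth T kT.
have := volC T X T0 Xu; rewrite -volE lee_fin => volX.
have {}volX : (size X)%:R * `|\det B| / (T + C) ^+ n <= fine (vol K).
  apply: volX => x /XP[[y yL yx] [w wT wx]].
  by rewrite -{1}yx -wx !proj_compl_id0.
apply: le_trans volX.
have TC0 : 0 < (T + C) ^+ n by rewrite exprn_gt0// ltr_wpDl.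
rewrite ler_pdivlMr// expr_div_n.
rewrite [leLHS](_ : _ = (m ^- (n - r) *
  (2 ^+ r * (n - r)`!%:R / n`!%:R / \prod_i l i) * (T - k) ^+ n) * `|\det B|).
  by rewrite ler_wpM2r.
by field; rewrite pnatr_eq0 -lt0n fact_gt0 !gt_eqF.
Qed.

End Final.

(** The d-th root of q is a lower bound of S. *)
Lemma inf_exprn_ge (R : realType) (S : set R) (q : R) d :
  S !=set0 -> (forall x, S x -> 0 < x) -> (forall x, S x -> q <= x ^+ d) ->
  q <= inf S ^+ d.
Proof.
move=> [x Sx] S0; case: d => [|d] Sq; first by rewrite expr0; exact: Sq Sx.
have inf0 : 0 <= inf S by apply: lb_le_inf; [exists x|move=> y /S0/ltW].
have [q0|q0] := leP q 0; first by rewrite (le_trans q0) ?exprn_ge0.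
pose t := q `^ d.+1%:R^-1.
have t0 : 0 <= t by exact: powR_ge0.
have tE : t ^+ d.+1 = q by rewrite -powR_mulrn// -powRrM mulVf// powRr1// ltW.
rewrite -tE lerXn2r ?nnegrE//; apply: lb_le_inf; first by exists x.
move=> y Sy; rewrite -(@ler_pXn2r _ d.+1)// ?nnegrE ?tE; [exact: Sq|exact/ltW/S0].
Qed.

(** If the minimum did not exist, its default value 0 would force v = 0. *)
Lemma succ_min_gt0 (R : realType) n (K Lam : set 'rV[R]_n) i v :
  dilate (succ_min K Lam i) K v -> v != 0 -> 0 < succ_min K Lam i.
Proof.
rewrite /succ_min /set_min; case: xgetP => [l _ [[]]//|_].
by move=> [k _ <-]; rewrite scale0r eqxx.
Qed.

Theorem theorem1 (R : realType) (n : nat) (n_ge1 : (1 <= n)%N)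
  (K : set 'rV[R]_n) (K_body : convex_body K) (K_sym : origin_symmetric K)
  (B : 'M[R]_n) (B_inv : B \in unitmx)
  (r : nat) (r_le_n : (r <= n)%N) (v : r.-tuple 'rV[R]_n)
  (v_lattice : forall i : 'I_r, lattice B (tnth v i))
  (v_min : forall i : 'I_r,
     dilate (succ_min K (lattice B) i.+1) K (tnth v i) /\ free (take i.+1 v)) :
  let L := <<v>>%VS in
  let rho := covering_radius (orth_compl L)
               (proj_compl L @` K) (proj_compl L @` lattice B) in
  (\prod_(1 <= i < r.+1) succ_min K (lattice B) i) * rho ^+ (n - r) >=
  2 ^+ r * (n - r)`!%:R / n`!%:R * (`|\det B| / fine (vol K)).
Proof.
have vfree : free v.
  case: r v r_le_n v_lattice v_min => [|r] v _ _ v_min.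
    by rewrite tuple0 nil_free.
  by have [_] := v_min ord_max; rewrite take_oversize// size_tuple.
pose l (i : 'I_r) := succ_min K (lattice B) i.+1.
have lP i : 0 < l i /\ dilate (l i) K (tnth v i).
  have [lv _] := v_min i; split=> //; apply: succ_min_gt0 lv _.
  apply: contraTneq vfree => vi0; apply/negP => /free_not0.
  by move=> /(_ _ (mem_tnth i v)); rewrite vi0 eqxx.
cbv zeta; set L := <<v>>%VS; rewrite big_add1 big_mkord.
have prod0 : 0 < \prod_(i < r) l i by apply: prodr_gt0 => i _; case: (lP i).
rewrite -ler_pdivrMl// /covering_radius; apply: inf_exprn_ge.
- by have [m mP] := covering_exists K_body K_sym B_inv L; exists m.
- by move=> m [].
move=> m [m0 cover].
have := minima_product_covering_ge K_body K_sym B_inv r_le_n v_lattice vfree lP m0 cover.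
have md0 : 0 < m ^+ (n - r) by rewrite exprn_gt0.
rewrite ler_pdivrMl//.
(* a volume equal to 0 or infinite has fine (vol K) = 0, whose inverse is 0 *)
have [vol0|vol_gt0] := eqVneq (fine (vol K)) 0.
  by rewrite vol0 invr0 !mulr0 => _; rewrite mulr_ge0// ltW.
have volE : (fine (vol K))%:E = vol K.
  by case: (vol K) vol_gt0 => //=; rewrite eqxx.
have V0 : 0 < fine (vol K) by rewrite lt_neqAle eq_sym vol_gt0 fine_ge0// vol_ge0.
rewrite -{1}volE lee_fin ler_pdivrMr ?mulr_gt0// => h.
by rewrite mulrA ler_pdivrMr// (le_trans h)// mulrC.
Qed.
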